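(* The metric space $(\mathsf{PDgm},d_E)$ is not a length space.
   Context: Let $\mathbb{R}^2_<=\{(b,d)\in\mathbb{R}^2: b<d\}$. A persistence diagram is a finite multiset $Y=\{(b_i,d_i)\}_{i=1}^N$ of points of $\mathbb{R}^2_<$; $\mathsf{PDgm}$ is the set of all of them. For $b\le d$, $\mathrm{rank}[Y](b,d)$ is the number (with multiplicity) of $(b_i,d_i)\in Y$ with $b_i\le b\le d<d_i$. The erosion distance $d_E(Y,Y')$ is the infimum of all $\varepsilon\ge0$ such that, for all $b\le d$, $\mathrm{rank}[Y](b-\varepsilon,d+\varepsilon)\le\mathrm{rank}[Y'](b,d)$ and $\mathrm{rank}[Y'](b-\varepsilon,d+\varepsilon)\le\mathrm{rank}[Y](b,d)$. For a metric space $(X,d)$ and a continuous path $\alpha:[0,1]\to X$, $\mathrm{len}_d(\alpha)=\sup\{\sum_i d(\alpha(t_i),\alpha(t_{i+1})):0=t_0<t_1<\dots<t_{n+1}=1\}$. The intrinsic metric associated to $d$ is $\hat d(x,x')=\inf\{\mathrm{len}_d(\alpha):\alpha(0)=x,\ \alpha(1)=x'\}$, the infimum being over continuous paths $\alpha:[0,1]\to X$. $(X,d)$ is a length space if $\hat d=d$. *)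

(* Defs.v *)
From HB Require Import structures.
From mathcomp Require Import all_boot all_order all_algebra finmap multiset.
From mathcomp Require Import all_classical all_reals all_analysis.
Import Order.TTheory GRing.Theory Num.Theory numFieldNormedType.Exports.

Set Implicit Arguments.
Unset Strict Implicit.
Unset Printing Implicit Defensive.

Local Open Scope classical_set_scope.
Local Open Scope ring_scope.

Section LengthSpace.
Context {R : realType}.

(* alpha is a function on R of which only the restriction to `[0, 1] matters;
   the partition 0 < t_1 < ... < t_(n+1) = 1 is given by the list s of the
   t_i with i >= 1, as in [variation] for real-valued functions *)
Definition path_length (X : metricType R) (alpha : R -> X) : \bar R :=
  ereal_sup [set (\sum_(0 <= i < size s)
                    mdist (alpha (nth 1 (0 :: s) i))
                          (alpha (nth 1 (0 :: s) i.+1)))%:E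
            | s in [set s | itv_partition 0 1 s]].

(* +oo when x and y are not joined by a path of finite length *)
Definition intrinsic_dist (X : metricType R) (x y : X) : \bar R :=
  ereal_inf [set path_length alpha
            | alpha in [set alpha : R -> X |
                [/\ {within `[0, 1], continuous alpha},
                    alpha 0 = x & alpha 1 = y]]].

Definition length_space (X : metricType R) : Prop :=
  forall x y : X, intrinsic_dist x y = (mdist x y)%:E.

End LengthSpace.

Definition R2lt (R : realType) : Type := {p : R * R | p.1 < p.2}.
HB.instance Definition _ (R : realType) := Choice.on (R2lt R).

Definition PDgm (R : realType) : Type := {mset R2lt R}%mset.
HB.instance Definition _ (R : realType) := Choice.on (PDgm R).

Section Erosion.
Context {R : realType}.
Implicit Types (Y Z : PDgm R) (b d e h : R).

(* a multiset coerces to a list repeating each element as often as its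
   multiplicity *)
Definition rank Y b d : nat :=
  count (fun p : R2lt R => [&& (val p).1 <= b, b <= d & d < (val p).2])
        (Y : {mset R2lt R}%mset).

Definition eroded Y Z e : Prop :=
  forall b d, b <= d -> (rank Y (b - e) (d + e) <= rank Z b d)%N /\
                        (rank Z (b - e) (d + e) <= rank Y b d)%N.

Definition erosion_dist Y Z : R := inf [set e | 0 <= e /\ eroded Y Z e].

Lemma rank_mono Y b b' d d' : b' <= b -> b <= d -> d <= d' ->
  (rank Y b' d' <= rank Y b d)%N.
Proof.
move=> bb bd dd; apply: sub_count => p /and3P[p1 _ p2] /=.
by rewrite (le_trans p1)//= bd/= (le_lt_trans dd).
Qed.

Lemma eroded_mono Y Z e e' : e <= e' -> 0 <= e -> eroded Y Z e -> eroded Y Z e'.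
Proof.
move=> ee e0 H b d bd; have [H1 H2] := H _ _ bd.
have h W : (rank W (b - e') (d + e') <= rank W (b - e) (d + e))%N.
  apply: rank_mono; [by rewrite lerB| |by rewrite lerD].
  by rewrite lerBlDr -addrA ler_wpDr// addr_ge0.
by split; [exact: leq_trans (h Y) H1|exact: leq_trans (h Z) H2].
Qed.

Lemma erodedC Y Z e : eroded Y Z e -> eroded Z Y e.
Proof. by move=> H b d /H []. Qed.

Lemma eroded_trans W Y Z e e' : 0 <= e -> 0 <= e' ->
  eroded Y W e -> eroded W Z e' -> eroded Y Z (e + e').
Proof.
move=> e0 e'0 H H' b d bd.
have bdx x : 0 <= x -> b - x <= d + x.
  by move=> x0; rewrite lerBlDr -addrA ler_wpDr// addr_ge0.
have [H1' _] := H' _ _ bd; have [H1 _] := H _ _ (bdx _ e'0).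
have [_ H2] := H _ _ bd; have [_ H2'] := H' _ _ (bdx _ e0).
split.
- have -> : b - (e + e') = b - e' - e by rewrite opprD addrA addrAC.
  have -> : d + (e + e') = d + e' + e by rewrite addrA addrAC.
  exact: leq_trans H1 H1'.
- by rewrite opprD !addrA; exact: leq_trans H2' H2.
Qed.

Lemma erosion_nonempty Y Z : [set e | 0 <= e /\ eroded Y Z e] !=set0.
Proof.
have bnd (s : seq (R2lt R)) :
    exists2 e, 0 <= e & forall p, p \in s -> (val p).2 - (val p).1 <= e.
  elim: s => [|p s [e e0 es]]; first by exists 0.
  exists (Num.max e ((val p).2 - (val p).1)); first by rewrite le_max e0.
  move=> q; rewrite inE => /orP[/eqP->|/es qs]; first by rewrite le_max lexx orbT.
  by rewrite le_max qs.
have rk0 W e b d : 0 <= e -> b <= d ->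
    (forall p, p \in (W : {mset R2lt R}%mset) -> (val p).2 - (val p).1 <= e) ->
    rank W (b - e) (d + e) = 0%N.
  move=> e0 bd We; apply/eqP; rewrite -leqn0 leqNgt -has_count.
  apply/hasPn => p /We pe; apply/negP => /and3P[p1 _ p2].
  suff : (val p).2 - (val p).1 > e by rewrite ltNge pe.
  rewrite ltrBrDr; apply: le_lt_trans p2.
  by rewrite addrC lerD2r (le_trans p1)// (le_trans _ bd)// lerBlDr ler_wpDr.
have [e e0 eY] := bnd (Y : {mset R2lt R}%mset).
have [e' e'0 eZ] := bnd (Z : {mset R2lt R}%mset).
exists (e + e'); split=> [|b d bd]; first exact: addr_ge0.
by rewrite !rk0// ?addr_ge0// => p; [move/eZ|move/eY] => h;
  apply: (le_trans h); rewrite ?lerDl ?lerDr.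
Qed.

Lemma erosion_lbound Y Z : lbound [set e | 0 <= e /\ eroded Y Z e] 0.
Proof. by move=> e []. Qed.

Lemma erosion_has_inf Y Z : has_inf [set e | 0 <= e /\ eroded Y Z e].
Proof.
by split; [exact: erosion_nonempty|exists 0; exact: erosion_lbound].
Qed.

Lemma erosion_dist_le Y Z e : 0 <= e -> eroded Y Z e -> erosion_dist Y Z <= e.
Proof. by move=> e0 H; apply: ge_inf => //; exact: (erosion_has_inf Y Z).2. Qed.

Lemma erosion_dist_ge0 Y Z : 0 <= erosion_dist Y Z.
Proof. exact: lb_le_inf (erosion_nonempty Y Z) (@erosion_lbound Y Z). Qed.

Lemma erosion_dist_lt Y Z e : erosion_dist Y Z < e -> eroded Y Z e.
Proof.
move=> lte; have [] := @inf_adherent _ _ (e - erosion_dist Y Z) _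
  (erosion_has_inf Y Z); first by rewrite subr_gt0.
rewrite -/(erosion_dist Y Z) subrKC => e' [e'0 H] e'e.
exact: eroded_mono (ltW e'e) e'0 H.
Qed.

Lemma erosion_distxx Y : erosion_dist Y Y = 0.
Proof.
apply/eqP; rewrite eq_le erosion_dist_ge0 andbT erosion_dist_le// => b d bd.
by rewrite subr0 addr0.
Qed.

Lemma erosion_distC Y Z : erosion_dist Y Z = erosion_dist Z Y.
Proof.
by congr inf; apply/seteqP; split=> e [e0 H]; split=> //; exact: erodedC.
Qed.

Lemma erosion_dist_triangle W Y Z :
  erosion_dist Y Z <= erosion_dist Y W + erosion_dist W Z.
Proof.
apply/ler_addgt0Pl => e e0; have e20 : 0 < e / 2 by rewrite divr_gt0.
rewrite [e]splitr addrC addrACA; apply: erosion_dist_le.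
  by rewrite !addr_ge0 ?erosion_dist_ge0 ?ltW.
apply: (@eroded_trans W); rewrite ?addr_ge0 ?erosion_dist_ge0 ?ltW//.
  by apply: erosion_dist_lt; rewrite ltrDl.
by apply: erosion_dist_lt; rewrite ltrDl.
Qed.

Lemma seq_gap (s : seq R) x :
  exists2 h, 0 < h & forall y, y \in s -> `|y - x| <= h -> y = x.
Proof.
elim: s => [|z s [h h0 hs]]; first by exists 1.
have [->|zx] := eqVneq z x.
  by exists h => // y; rewrite inE => /orP[/eqP->//|]; exact: hs.
have zx0 : 0 < `|z - x| / 2 by rewrite divr_gt0// normr_gt0 subr_eq0.
exists (Num.min h (`|z - x| / 2)); first by rewrite lt_min h0.
move=> y; rewrite inE le_min => /orP[/eqP->|/hs ys] /andP[yh]; last by rewrite ys.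
by rewrite leNgt gtr_pMr ?invf_lt1 ?ltr1n// normr_gt0 subr_eq0.
Qed.

Lemma rank_gap Y b d : exists2 h, 0 < h &
  forall e e', 0 <= e <= h -> 0 <= e' <= h -> b + e <= d + e' -> b <= d ->
  rank Y (b + e) (d + e') = rank Y b d.
Proof.
have [h h0 H] := seq_gap
  [seq (val p).1 | p : R2lt R <- (Y : {mset R2lt R}%mset)] b.
have [k k0 K] := seq_gap
  [seq (val p).2 | p : R2lt R <- (Y : {mset R2lt R}%mset)] d.
exists (Num.min h k); first by rewrite lt_min h0.
move=> e e' /andP[e0]; rewrite le_min => /andP[eh _] /andP[e'0].
rewrite le_min => /andP[_ ek] bde bd; apply: eq_in_count => p pY /=.
rewrite bde bd/=; congr (_ && _); apply/idP/idP.
- move=> pbe; rewrite leNgt; apply/negP => bp.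
  move: (bp); rewrite (H (val p).1) ?ltxx//;
    first exact: (map_f (fun q : R2lt R => (val q).1) pY).
  by rewrite ger0_norm ?subr_ge0 ?(ltW bp)// lerBlDl (le_trans pbe)// lerD2l.
- by move=> pb; rewrite ler_wpDr.
- by apply: le_lt_trans; rewrite lerDl.
- move=> dp; rewrite ltNge; apply/negP => pde.
  move: (dp); rewrite (K (val p).2) ?ltxx//;
    first exact: (map_f (fun q : R2lt R => (val q).2) pY).
  by rewrite ger0_norm ?subr_ge0 ?(ltW dp)// lerBlDl (le_trans pde)// lerD2l.
Qed.

Lemma erosion0_rank Y Z b d : erosion_dist Y Z = 0 -> b <= d ->
  (rank Y b d <= rank Z b d)%N.
Proof.
move=> D0 bd; have [h h0 H] := rank_gap Y b d; have [k k0 K] := rank_gap Z b d.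
pose e := Num.min h k / 2.
have m0 : 0 < Num.min h k by rewrite lt_min h0.
have e0 : 0 < e by rewrite divr_gt0.
have ee0 : 0 <= e + e by rewrite addr_ge0// ltW.
have /andP[eh ek] : (e + e <= h) && (e + e <= k) by rewrite -splitr -le_min.
have {}ek : e <= k by apply: le_trans ek; rewrite lerDl ltW.
have : eroded Y Z e by apply: erosion_dist_lt; rewrite D0.
move=> /(_ (b + e) (d + e)) [|+ _]; first by rewrite lerD2r.
rewrite addrK -addrA -[in X in rank Y X _](addr0 b) H//; last 3 first.
- by rewrite lexx/= ltW.
- by rewrite ee0.
- by rewrite addr0 ler_wpDr.
by rewrite K// ?lerD2r// (ltW e0).
Qed.

Lemma rank_box Y b b' d d' : b' <= b -> b <= d' -> d' <= d ->
  (count (fun p : R2lt R =>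
       (b' < (val p).1 <= b)%R && (d' < (val p).2 <= d)%R)
     (Y : {mset R2lt R}%mset) + rank Y b' d' + rank Y b d =
   rank Y b d' + rank Y b' d)%N.
Proof.
move=> bb bd dd; rewrite /rank.
rewrite bd (le_trans bb bd) (le_trans bd dd) (le_trans bb (le_trans bd dd)).
elim: (enum_mset _) => //= p s IH.
rewrite [X in (X + _ = _)%N]addnACA addnACA IH [RHS]addnACA.
congr (_ + _)%N.
have h1 : (val p).1 <= b' -> (val p).1 <= b by move=> /le_trans; exact.
have h2 : d < (val p).2 -> d' < (val p).2 by exact: le_lt_trans.
rewrite ltNge [(val p).2 <= d]leNgt.
move: h1 h2; do 2 case: (_ <= _); do 2 case: (_ < _) => //=.
all: by try (by move=> /(_ isT)); try (by move=> _ /(_ isT)).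
Qed.

Lemma rank_inj Y Z : (forall b d, b <= d -> rank Y b d = rank Z b d) -> Y = Z.
Proof.
move=> YZ; apply/msetP => p; rewrite -!count_mem_mset.
pose s : seq (R2lt R) := (Y : {mset _}%mset) ++ (Z : {mset _}%mset).
have [h h0 H] := seq_gap [seq (val q).1 | q : R2lt R <- s] (val p).1.
have [k k0 K] := seq_gap [seq (val q).2 | q : R2lt R <- s] (val p).2.
pose l := Num.min k ((val p).2 - (val p).1).
have l0 : 0 < l by rewrite lt_min k0 subr_gt0 (valP p).
have lk : l <= k by rewrite ge_min lexx.
have pl : (val p).1 <= (val p).2 - l by rewrite lerBrDl -lerBrDr ge_min lexx orbT.
have box W : {subset (W : {mset _}%mset) <= s} -> count_mem p W = count
    (fun q : R2lt R => ((val p).1 - h < (val q).1 <= (val p).1) &&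
      ((val p).2 - l < (val q).2 <= (val p).2)) (W : {mset R2lt R}%mset).
  move=> Ws; apply: eq_in_count => q /Ws qs /=; apply/eqP/andP => [->|].
    by rewrite !lexx !andbT !ltrBlDr !ltrDl.
  move=> [/andP[q1 q1'] /andP[q2 q2']]; apply: val_inj.
  rewrite [LHS]surjective_pairing [RHS]surjective_pairing.
  congr pair.
    apply: H; first exact: (map_f (fun q : R2lt R => (val q).1) qs).
    by rewrite ler0_norm ?subr_le0// opprB lerBlDr -lerBlDl ltW.
  apply: K; first exact: (map_f (fun q : R2lt R => (val q).2) qs).
  rewrite ler0_norm ?subr_le0// opprB lerBlDr -lerBlDl.
  by rewrite ltW// (le_lt_trans _ q2)// lerB.
have ph : (val p).1 - h <= (val p).1 by rewrite lerBlDr lerDl ltW.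
have pk : (val p).2 - l <= (val p).2 by rewrite lerBlDr lerDl ltW.
have EY := rank_box Y ph pl pk; have EZ := rank_box Z ph pl pk.
have p12 := ltW (valP p).
rewrite !box; last 2 first.
- by move=> q qZ; rewrite mem_cat qZ orbT.
- by move=> q qY; rewrite mem_cat qY.
move: EY; rewrite !YZ ?(le_trans ph)// -EZ -!addnA => /eqP.
by rewrite eqn_add2r => /eqP.
Qed.

Lemma erosion_dist_positivity Y Z : erosion_dist Y Z = 0 -> Y = Z.
Proof.
move=> D0; apply: rank_inj => b d bd; apply/eqP; rewrite eqn_leq.
by rewrite !erosion0_rank// erosion_distC.
Qed.

End Erosion.

HB.instance Definition _ (R : realType) := isMetric.Build R (PDgm R)
  (@erosion_distxx R) (@erosion_dist_positivity R) (@erosion_distC R)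
  (@erosion_dist_triangle R).

(* Main.v *)
Require Import Defs.
From mathcomp Require Import all_boot all_order all_algebra.
From mathcomp Require Import all_classical all_reals all_analysis.
From mathcomp Require Import finmap multiset lra.
Import Order.TTheory GRing.Theory Num.Theory numFieldNormedType.Exports.

(** In a length space any two points have approximate midpoints: on a path
whose length is close to the distance of its ends, stop where half of the
distance has been covered ([length_space_midpoint]).  So it is enough to find
two diagrams without approximate midpoints.  Take, as bars birth-death,

  Y = {(0, 22), (8, 30)}    and    Z = {(4, 26), (12, 18)}.

They are at erosion distance at most 4 ([erosion_dist_staggered_nested]):
each bar of Y, shrunk by 4 at both ends, lies in (4, 26), and the overlap
(8, 22) of the bars of Y, shrunk by 4, is (12, 18), where the bars of Z
overlap; conversely (4, 26) shrinks to (8, 22), and the overlap (12, 18)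
shrinks into (8, 22).  Both bars of Y are compared with the same bar of Z here,
whereas a matching of the two multisets has to send one of them at distance
11 or more.

A diagram M within 3 of both does not exist ([staggered_nested_separated]).
Shrunk by 3, the bars (0, 22), (4, 26) and (8, 30) become (3, 19), (7, 23) and
(11, 27), and each of these lies in some bar of M.  The middle one meets the
others in (7, 19) and (11, 23).  Neither of these intersections lies in
(9, 21), which is the overlap of the bars of Z extended by 3, so each is
contained in at most one bar of M.  Since the rank function is supermodular
([rank_supermodular]), one bar of M then contains all three intervals, hence
(3, 27).  But then a bar of Y would have to contain (6, 24), and neither
does. *)

Set Implicit Arguments.
Unset Strict Implicit.
Unset Printing Implicit Defensive.

Local Open Scope classical_set_scope.
Local Open Scope ring_scope.

Section Midpoint.
Context {R : realType} {X : metricType R}.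
Implicit Types (x y : X) (alpha : R -> X).

Lemma continuous_mdistr x : continuous (mdist x : X -> R^o).
Proof.
move=> y; apply/cvgrPdist_lt => e e0; apply/nbhs_ballP; exists e => //= z.
rewrite ballEmdist /= => yz; apply: le_lt_trans yz.
have := metric_triangle x y z; have := metric_triangle x z y.
rewrite (metric_sym z y) ler_norml => *; apply/andP; split; lra.
Qed.

(** The two-step partition through t is one of those over which the length
is a supremum. *)
Lemma path_length_ge2 alpha t : 0 < t < 1 ->
  ((mdist (alpha 0) (alpha t) + mdist (alpha t) (alpha 1))%:E
     <= path_length alpha)%E.
Proof.
move=> /andP[t0 t1]; apply: ereal_sup_ubound; exists [:: t; 1] => /=.
  by split; rewrite /= ?t0 ?t1.
by rewrite !big_nat_recl// big_geq// addr0.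
Qed.

Lemma length_space_midpoint x y e : length_space X -> 0 < e ->
  exists z, mdist x z = mdist x y / 2 /\ mdist z y < mdist x y / 2 + e.
Proof.
move=> XL e0; have [xy0|xy0] := eqVneq (mdist x y) 0.
  by exists x; rewrite mdistxx xy0 mul0r add0r.
have {xy0} xy_gt0 : 0 < mdist x y by rewrite lt_neqAle eq_sym xy0 mdist_ge0.
have : (intrinsic_dist x y < (mdist x y + e)%:E)%E.
  by rewrite XL lte_fin ltrDl.
move=> /ereal_inf_lt[_ [alpha [calpha a0 a1] <-] len].
have [||t t01 xt] := @IVT R (fun t => mdist x (alpha t)) 0 1 (mdist x y / 2) ler01.
- move=> u; apply: continuous_comp; first exact: calpha.
  exact: continuous_mdistr.
- rewrite a0 a1 mdistxx ge_min le_max; lra.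
(* t is an interior point because half of a positive distance is neither zero
   nor the whole *)
have {t01} t01 : 0 < t < 1.
  move: t01; rewrite in_itv /= => /andP[t0 t1].
  rewrite !lt_neqAle t0 t1 !andbT; apply/andP; split; apply/eqP => tE; move: xt.
    by rewrite -tE a0 mdistxx; lra.
  by rewrite tE a1; lra.
exists (alpha t); split => //.
have := le_lt_trans (path_length_ge2 alpha t01) len.
rewrite a0 a1 xt lte_fin; lra.
Qed.

End Midpoint.

Section Diagrams.
Context {R : realType}.
Implicit Types (M Y Z : PDgm R) (p q : R2lt R) (b d e : R).

(** With -d as second coordinate, the rank becomes a cumulative count of
points in the product order, and the two ranks on the right are taken at the
join and at the meet of the places on the left. *)
Lemma rank_supermodular M b b' d d' : b <= b' -> b' <= d -> d <= d' ->
  (rank M b d + rank M b' d' <= rank M b' d + rank M b d')%N.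
Proof. by move=> bb bd dd; rewrite -(rank_box M bb bd dd) -addnA leq_addl. Qed.

(** Every bar over [b, d] or over [b', d'] is also over their intersection
[b', d].  If there is only one bar over the latter, it is over both intervals,
hence over their union [b, d']. *)
Lemma rank_supermodular_gt0 M b b' d d' : b <= b' -> b' <= d -> d <= d' ->
  (0 < rank M b d)%N -> (0 < rank M b' d')%N -> (rank M b' d <= 1)%N ->
  (0 < rank M b d')%N.
Proof.
move=> bb bd dd r1 r2 r3; have := rank_supermodular M bb bd dd.
case: (rank M b d') => // le; move: (leq_trans (leq_add r1 r2) le).
by rewrite addn0 leqNgt ltnS r3.
Qed.

Lemma eroded_rank Y Z e b b' d d' : eroded Y Z e ->
  0 <= e -> b + e <= b' -> b' <= d' -> d' + e <= d ->
  (rank Y b d <= rank Z b' d')%N.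
Proof.
move=> YZ e0 bb bd dd; apply: leq_trans (YZ _ _ bd).1.
have ? : b' - e <= d' + e by lra.
by apply: rank_mono; lra.
Qed.

Definition bar b d (bd : b < d) : R2lt R := exist _ (b, d) bd.

Definition diagram2 p q : PDgm R := seq_mset [:: p; q].

Lemma rank_diagram2 p q b d : rank (diagram2 p q) b d =
  ([&& (val p).1 <= b, b <= d & d < (val p).2]%R +
   [&& (val q).1 <= b, b <= d & d < (val q).2]%R)%N.
Proof. by rewrite /rank (permP (perm_eq_seq_mset _))/= addn0. Qed.

Fact lt_0_22 : 0 < 22 :> R. Proof. lra. Qed.
Fact lt_8_30 : 8 < 30 :> R. Proof. lra. Qed.
Fact lt_4_26 : 4 < 26 :> R. Proof. lra. Qed.
Fact lt_12_18 : 12 < 18 :> R. Proof. lra. Qed.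

Definition staggered : PDgm R := diagram2 (bar lt_0_22) (bar lt_8_30).
Definition nested : PDgm R := diagram2 (bar lt_4_26) (bar lt_12_18).

Lemma rank_staggered b d : b <= d -> rank staggered b d =
  (((0 <= b) && (d < 22))%R + ((8 <= b) && (d < 30))%R)%N.
Proof. by move=> bd; rewrite rank_diagram2/= bd. Qed.

Lemma rank_nested b d : b <= d -> rank nested b d =
  (((4 <= b) && (d < 26))%R + ((12 <= b) && (d < 18))%R)%N.
Proof. by move=> bd; rewrite rank_diagram2/= bd. Qed.

Ltac split_comparisons :=
  repeat match goal with
  | |- context [(?x <= ?y)%R] => case: (lerP x y) => ?
  | |- context [(?x < ?y)%R] => case: (ltrP x y) => ?
  end => //=; lra.

Lemma erosion_dist_staggered_nested : erosion_dist staggered nested <= 4.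
Proof.
apply: erosion_dist_le => [|b d bd]; first lra.
have bd4 : b - 4 <= d + 4 by lra.
rewrite !rank_staggered// !rank_nested//.
split; split_comparisons.
Qed.

Lemma staggered_nested_separated M :
  eroded staggered M 3 -> eroded M nested 3 -> False.
Proof.
move=> YM MZ.
(* a bar does not contain its death, so each bar is tested on an interval that
   ends one unit earlier; the numbers leave room for that *)
have M1 : (0 < rank M 3 18)%N.
  apply: leq_trans (eroded_rank (b := 0) (d := 21) YM _ _ _ _); try lra.
  by rewrite rank_staggered; [split_comparisons|lra].
have M2 : (0 < rank M 11 26)%N.
  apply: leq_trans (eroded_rank (b := 8) (d := 29) YM _ _ _ _); try lra.
  by rewrite rank_staggered; [split_comparisons|lra].
have M3 : (0 < rank M 7 22)%N.
  apply: leq_trans (eroded_rank (b := 4) (d := 25) (erodedC MZ) _ _ _ _); try lra.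
  by rewrite rank_nested; [split_comparisons|lra].
have M23 : (0 < rank M 7 26)%N.
  apply: (rank_supermodular_gt0 _ _ _ M3 M2); try lra.
  apply: leq_trans (eroded_rank (b' := 14) (d' := 19) MZ _ _ _ _) _; try lra.
  by rewrite rank_nested; [split_comparisons|lra].
have : (0 < rank M 3 26)%N.
  apply: (rank_supermodular_gt0 _ _ _ M1 M23); try lra.
  apply: leq_trans (eroded_rank (b' := 10) (d' := 15) MZ _ _ _ _) _; try lra.
  by rewrite rank_nested; [split_comparisons|lra].
apply/negP; rewrite -leqNgt.
apply: leq_trans (eroded_rank (b' := 6) (d' := 23) (erodedC YM) _ _ _ _) _; try lra.
by rewrite rank_staggered; [split_comparisons|lra].
Qed.

End Diagrams.

Theorem corollary4p8 (R : realType) : ~ length_space (PDgm R).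
Proof.
move=> L.
have [M [YM MZ]] := @length_space_midpoint _ _ staggered nested 1 L ltr01.
have YZ : mdist (@staggered R) nested <= 4 := erosion_dist_staggered_nested.
apply: (@staggered_nested_separated _ M); apply: erosion_dist_lt.
  by rewrite -[erosion_dist _ _]/(mdist staggered M) YM; lra.
by apply: lt_le_trans MZ _; lra.
Qed.
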